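(* Let $n\ge1$, let $L_n$ be the lattice of arithmetic progressions in $[n]$ with Möbius function $\mu_n$. For every $x\in L_n$ with $x\ne[n]$, $$\mu_n(x,[n])=\begin{cases}(-1)^k, & \text{if } x \text{ is the meet of } k \text{ coatoms of } L_n;\\ 0, & \text{if } x \text{ is not a meet of coatoms of } L_n.\end{cases}$$
   Context: $L_n$ is the set of all subsets of $[n]=\{1,\ldots,n\}$ that are arithmetic progressions $\{a,a+r,\ldots,a+(k-1)r\}$ ($a$, $r\ge1$, $k\ge0$ integers; including $\emptyset$, singletons and $2$-element subsets), ordered by inclusion; it is a lattice with minimum $\emptyset$, maximum $[n]$, and meet equal to intersection. Coatoms are elements covered by $[n]$; ''the meet of $k$ coatoms'' means the meet of a set of $k$ distinct coatoms (such a set is unique when it exists). The Möbius function is defined by $\mu_n(x,x)=1$ and $\mu_n(x,y)=-\sum_{x\le z<y}\mu_n(x,z)$ for $x<y$. *)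

(* Defs.v *)
From HB Require Import structures.
From mathcomp Require Import all_boot all_order all_algebra.
From mathcomp Require Import zify.

Set Implicit Arguments.
Unset Strict Implicit.
Unset Printing Implicit Defensive.

Import Order.TTheory GRing.Theory.

(* The ground set [n] = {1, ..., n} is encoded by 'I_n, the ordinal i standing
   for the number i.+1; [elements A] is the set A read in {1, ..., n}. *)
Definition elements n (A : {set 'I_n}) : seq nat := [seq (i : 'I_n).+1 | i in A].

Definition ap_terms (a r k : nat) : seq nat := [seq a + j * r | j <- iota 0 k].

(* A nonempty progression inside {1, ..., n} has a natural first term, so a
   ranging over nat loses nothing. *)
Definition is_AP n (A : {set 'I_n}) : Prop :=
  exists a r k : nat, 1 <= r /\ elements A =i ap_terms a r k.

(* Decidable form of [is_AP], with bounds on the parameters; the common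
   difference is r.+1.  See [is_apP]. *)
Definition is_ap n (A : {set 'I_n}) : bool :=
  [exists a : 'I_n.+1, exists r : 'I_n.+1, exists k : 'I_n.+1,
     perm_eq (elements A) (ap_terms a r.+1 k)].

Lemma mem_elements n (A : {set 'I_n}) (i : 'I_n) :
  (i.+1 \in elements A) = (i \in A).
Proof.
apply/imageP/idP => [[j jA [/val_inj ->]] //|iA]; by exists i.
Qed.

Lemma elements_bound n (A : {set 'I_n}) m : m \in elements A -> 0 < m <= n.
Proof. by case/imageP=> i _ ->; rewrite /= ltn_ord. Qed.

Lemma elements_uniq n (A : {set 'I_n}) : uniq (elements A).
Proof. by apply/dinjectiveP => i j _ _ [/val_inj]. Qed.

Lemma ap_termsP a r k m :
  reflect (exists2 j, j < k & m = a + j * r) (m \in ap_terms a r k).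
Proof.
by apply: (iffP mapP) => -[j]; rewrite ?mem_iota => jk ->; exists j;
  rewrite ?mem_iota.
Qed.

Lemma ap_terms_uniq a r k : 0 < r -> uniq (ap_terms a r k).
Proof.
move=> r0; rewrite map_inj_uniq ?iota_uniq // => i j /addnI /eqP.
by rewrite eqn_pmul2r // => /eqP.
Qed.

Lemma is_apP n (A : {set 'I_n}) : reflect (is_AP A) (is_ap A).
Proof.
apply: (iffP existsP) => [[a /existsP[r /existsP[k /perm_mem e]]]|].
  by exists a, r.+1, k.
move=> [a [r [k [r0 e]]]].
have bnd j : j < k -> 0 < a + j * r <= n.
  by move=> jk; apply: (@elements_bound n A); rewrite e; apply/ap_termsP; exists j.
suff [a' [r' [k' [le1 le2 le3 e']]]] : exists a' r' k' : nat,
   [/\ a' <= n, r' <= n, k' <= n & elements A =i ap_terms a' r'.+1 k'].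
  exists (inord a'); apply/existsP; exists (inord r'); apply/existsP.
  exists (inord k'); rewrite !inordK //; apply: uniq_perm => //.
    exact: elements_uniq.
  exact: ap_terms_uniq.
case: k e bnd => [|[|k]] e bnd.
- by exists 0, 0, 0; split.
- have := bnd 0 isT; rewrite mul0n addn0 => /andP[a0 an].
  exists a, 0, 1; split=> //; first exact: leq_trans an.
- have /andP[a0 _] := bnd 0 isT.
  have /andP[_ rn] := bnd 1 isT.
  have /andP[_ kn] := bnd k.+1 (ltnSn _).
  exists a, r.-1, k.+2; rewrite prednK //.
  by split=> //; nia.
Qed.

(* A nonempty progression is the part of a residue class lying between its
   first term a and its last term b. *)
Lemma is_ap_cases n (A : {set 'I_n}) : is_ap A ->
  A = set0 \/ exists a b r, forall i : 'I_n,
    (i \in A) = [&& a <= i.+1, i.+1 <= b & r %| i.+1 - a].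
Proof.
move/is_apP => [a [r [[|k] [r0 e]]]].
  left; apply/setP => i; rewrite inE -mem_elements e.
  by apply/ap_termsP => -[].
right; exists a, (a + k * r), r => i; rewrite -mem_elements e.
apply/ap_termsP/and3P => [[j jk ->]|[ai ib /dvdnP[j ij]]].
  by rewrite leq_addr leq_add2l leq_mul2r -ltnS jk orbT addKn dvdn_mull.
by exists j; first rewrite ltnS -(leq_pmul2r r0); lia.
Qed.

Lemma ap_intro n (A : {set 'I_n}) (a b : 'I_n) r : 0 < r ->
  (forall i : 'I_n, (i \in A) = [&& a <= i, i <= b & r %| i - a]) -> is_ap A.
Proof.
move=> r0 e; apply/is_apP.
have [ab|ba] := leqP a b; last first.
  exists 0, 1, 0; split=> // m; apply/idP/idP/imageP => -[i].
  by rewrite e => /and3P[]; lia.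
exists a.+1, r, ((b - a) %/ r).+1; split=> // m.
apply/idP/idP => [/imageP[i iA ->]|/ap_termsP[j]].
  apply/ap_termsP; move: iA; rewrite e => /and3P[ai ib /dvdnP[j ij]].
  by exists j; [rewrite ltnS leq_divRL //|]; lia.
rewrite ltnS leq_divRL // => jb ->.
have lt : a + j * r < n by have := ltn_ord b; lia.
apply/imageP; exists (Ordinal lt) => //; rewrite e /= addKn dvdn_mull // leq_addr andbT /=; lia.
Qed.

Lemma is_ap0 n : is_ap (set0 : {set 'I_n}).
Proof.
apply/is_apP; exists 0, 1, 0; split=> // m.
by apply/idP/idP/imageP => -[i]; rewrite inE.
Qed.

Lemma is_apT n : is_ap [set: 'I_n].
Proof.
case: n => [|n]; first by rewrite (_ : [set: 'I_0] = set0) ?is_ap0 //; apply/setP => -[].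
apply: (@ap_intro _ _ ord0 ord_max 1) => // i.
by rewrite inE dvd1n leq_ord.
Qed.

Lemma is_apI n (A B : {set 'I_n}) : is_ap A -> is_ap B -> is_ap (A :&: B).
Proof.
move=> /is_ap_cases[->|[a [b [r eA]]]]; first by rewrite set0I is_ap0.
move=> /is_ap_cases[->|[c [d [s eB]]]]; first by rewrite setI0 is_ap0.
have [->|[i0 i0C]] := set_0Vmem (A :&: B); first exact: is_ap0.
case: (arg_minnP (fun i : 'I_n => val i) i0C) => /= u uC umin.
case: (arg_maxnP (fun i : 'I_n => val i) i0C) => /= v vC vmax.
have dvd_shift q x (i : 'I_n) : x <= u.+1 -> u <= i -> q %| u.+1 - x ->
    (q %| i.+1 - x) = (q %| i - u).
  by move=> xu ui qu; rewrite (_ : i.+1 - x = (u.+1 - x) + (i - u)) ?dvdn_addr //; lia.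
have {}uC : u \in A :&: B by [].
have {}vC : v \in A :&: B by [].
move: (uC) (vC); rewrite !inE !eA !eB => /andP[/and3P[au ub ru] /andP[cu /andP[ud su]]].
move=> /andP[/and3P[av vb rv] /andP[cv /andP[vd sv]]].
have key (i : 'I_n) : (i \in A :&: B) = [&& u <= i, i <= v & lcmn r s %| i - u].
  apply/idP/and3P => [iC|[ui iv]].
    have ui := umin _ iC; have iv := vmax _ iC; split=> //.
    move: iC; rewrite !inE eA eB dvdn_lcm => /andP[/and3P[_ _ ri] /and3P[_ _ si]].
    by rewrite -(dvd_shift r a) // -(dvd_shift s c) // ri si.
  rewrite dvdn_lcm inE eA eB => /andP[ri si].
  rewrite (dvd_shift r a) // (dvd_shift s c) // ri si !andbT.
  have iv' : i.+1 <= v.+1 by [].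
  have ui' : u.+1 <= i.+1 by [].
  rewrite (leq_trans au ui') (leq_trans cu ui').
  by rewrite (leq_trans iv' vb) (leq_trans iv' vd).
have [l0|] := posnP (lcmn r s); last by move/ap_intro => /(_ _ _ u v); apply.
apply: (@ap_intro _ _ u u 1) => // i.
rewrite key l0 dvd0n dvd1n subn_eq0 andbT.
apply/idP/idP => [/and3P[ui iv iu]|/andP[ui iu]]; first by rewrite ui.
by rewrite ui iu andbT; apply: leq_trans iu _; apply: umin.
Qed.

Record APset (n : nat) := MkAPset { ap_set :> {set 'I_n}; _ : is_ap ap_set }.

HB.instance Definition _ n := [isSub for @ap_set n].
HB.instance Definition _ n := [Finite of APset n by <:].

Fact ap_display : Order.disp_t. Proof. exact: Order.Disp tt tt. Qed.

Section Lattice.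
Variable n : nat.
Implicit Types x y z : APset n.

Definition ap_le x y := ap_set x \subset ap_set y.

Fact ap_le_refl : reflexive ap_le.
Proof. by move=> x; apply: subxx. Qed.
Fact ap_le_anti : antisymmetric ap_le.
Proof. by move=> x y xy; apply/val_inj/eqP; rewrite eqEsubset. Qed.
Fact ap_le_trans : transitive ap_le.
Proof. by move=> y x z; apply: subset_trans. Qed.

HB.instance Definition _ := @Order.Le_isPOrder.Build ap_display (APset n)
  ap_le ap_le_refl ap_le_anti ap_le_trans.

Definition ap_bot : APset n := MkAPset (is_ap0 n).
Definition ap_top : APset n := MkAPset (is_apT n).

Fact ap_le0x x : (ap_bot <= x)%O.
Proof. exact: sub0set. Qed.
Fact ap_lex1 x : (x <= ap_top)%O.
Proof. exact: subsetT. Qed.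

HB.instance Definition _ :=
  Order.hasBottom.Build ap_display (APset n) ap_le0x.
HB.instance Definition _ :=
  Order.hasTop.Build ap_display (APset n) ap_lex1.

Definition ap_meet x y : APset n := MkAPset (is_apI (valP x) (valP y)).

Fact ap_lexI x y z : (x <= ap_meet y z)%O = (x <= y)%O && (x <= z)%O.
Proof. exact: subsetI. Qed.

HB.instance Definition _ :=
  Order.POrder_isMeetSemilattice.Build ap_display (APset n) ap_lexI.

Definition ap_join x y : APset n :=
  (\meet_(z : APset n | (x <= z) && (y <= z)) z)%O.

Fact ap_leUx x y z : (ap_join x y <= z)%O = (x <= z)%O && (y <= z)%O.
Proof.
apply/idP/idP => [|xyz]; last exact: meets_inf.
move=> le; apply/andP; split; apply: le_trans le;
  by apply/meetsP => t /andP[].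
Qed.

HB.instance Definition _ :=
  Order.POrder_isJoinSemilattice.Build ap_display (APset n) ap_leUx.

Lemma ap_leE x y : (x <= y)%O = (ap_set x \subset ap_set y).
Proof. by []. Qed.

Lemma ap_set_meet x y : ap_set (x `&` y)%O = ap_set x :&: ap_set y.
Proof. by []. Qed.

Lemma ap_set_top : ap_set (\top : APset n)%O = [set: 'I_n].
Proof. by []. Qed.

Lemma ap_set_bot : ap_set (\bot : APset n)%O = set0.
Proof. by []. Qed.

End Lattice.

Section Posets.
Variables (d : Order.disp_t) (T : finPOrderType d).
Implicit Types x y z : T.
Local Open Scope order_scope.

Definition covers x y : bool := (x < y) && [forall z, ~~ (x < z < y)].

(* The first argument bounds the recursion depth. *)
Fixpoint mobius_rec (m : nat) x y : int :=
  if m is m'.+1 then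
    if x == y then 1%R
    else if x < y then (- \sum_(z : T | (x <= z < y)%O) mobius_rec m' x z)%R
    else 0%R
  else 0%R.

Definition mobius x y : int := mobius_rec #|T| x y.

Lemma mobius_rec_stable m1 m2 x y :
  (#|[pred z | (z <= y)%O]| <= m1)%N -> (#|[pred z | (z <= y)%O]| <= m2)%N ->
  mobius_rec m1 x y = mobius_rec m2 x y.
Proof.
have pos (t : T) : (0 < #|[pred z | (z <= t)%O]|)%N by apply/card_gt0P; exists t; rewrite inE.
elim: m1 m2 y => [|m1 IH] [|m2] y.
- by [].
- by move=> h; have := leq_trans (pos y) h.
- by move=> _ h; have := leq_trans (pos y) h.
move=> h1 h2 /=; case: eqP => // _; case: ifP => // _; congr (- _)%R.
apply: eq_bigr => z /andP[_ zy].
have lt : (#|[pred t | (t <= z)%O]| < #|[pred t | (t <= y)%O]|)%N.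
  apply: proper_card; apply/properP; split.
    by apply/subsetP => t; rewrite !inE => /le_trans; apply; apply: ltW.
  by exists y; rewrite !inE ?lexx // -?ltNge ?lt_geF.
by apply: IH; rewrite -ltnS; apply: leq_trans lt _.
Qed.

Lemma mobius_refl x : mobius x x = 1%R.
Proof.
rewrite /mobius; have : (0 < #|T|)%N by apply/card_gt0P; exists x.
by case: #|T| => //= m _; rewrite eqxx.
Qed.

Lemma mobius_lt x y : x < y ->
  mobius x y = (- \sum_(z : T | (x <= z < y)%O) mobius x z)%R.
Proof.
move=> xy; have le (t : T) : (#|[pred z | (z <= t)%O]| <= #|T|)%N by apply: max_card.
rewrite {1}/mobius (@mobius_rec_stable #|T| #|T|.+1) //=; last exact: leqW.
by rewrite xy; case: eqP xy => // ->; rewrite ltxx.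
Qed.

End Posets.

Definition coatom d (T : finTBLatticeType d) (c : T) : bool :=
  covers c (\top)%O.

Definition meet_of_coatoms d (T : finTBLatticeType d) (k : nat) (x : T) : Prop :=
  exists S : {set T}, [/\ #|S| = k, {in S, forall c, coatom c}
                        & x = (\meet_(c in S) c)%O].

(* Main.v *)
(* By the crosscut theorem, mu(x, top) is the sum of (-1)^|S| over the sets S of
   coatoms with meet x, so it suffices that distinct sets of coatoms have
   distinct meets.  This holds because every coatom c misses some element that
   all the other coatoms contain.  Indexing [n] by 0, ..., N with N = n - 1, the
   coatoms are the complement of 0, the complement of N, and the multiples of p
   for the primes p dividing N. *)
Require Import Defs.
From mathcomp Require Import all_boot all_order all_algebra.
From mathcomp Require Import zify.
Import GRing.Theory Order.TTheory.

Set Implicit Arguments.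
Unset Strict Implicit.
Unset Printing Implicit Defensive.

(** Expand the product of [1 - [i in A]] over all [i]: a set [S] not inside [A] contributes 0, and
    any element of [A] makes the product vanish. *)
Lemma sum_signr_subset (R : comPzRingType) (T : finType) (A : {set T}) :
  (\sum_(S : {set T} | S \subset A) (-1) ^+ #|S| = (A == set0)%:R :> R)%R.
Proof.
transitivity (\prod_(i : T) (- (i \in A)%:R + 1) : R)%R; last first.
  have [->|[a aA]] := set_0Vmem A.
    by rewrite eqxx big1 // => i _; rewrite inE oppr0 add0r.
  rewrite (bigD1 a) //= aA addNr mul0r.
  by case: eqP aA => // ->; rewrite inE.
rewrite bigA_distr big_mkcond; apply: eq_big => [S|S _]; first by rewrite inE.
rewrite -big_mkcond /=; case: ifP => [/subsetP SA|/negbT /subsetPn[i iS iA]].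
  by rewrite -prodr_const; apply: eq_bigr => i /SA ->.
by rewrite (bigD1 i) //= (negbTE iA) oppr0 mul0r.
Qed.

(** * The crosscut theorem for the coatoms of a finite lattice *)

Section Crosscut.
Variables (d : Order.disp_t) (T : finTBLatticeType d).
Implicit Types x y c : T.
Local Open Scope order_scope.

Lemma coatom_above x : x < \top -> exists2 c, coatom c & x <= c.
Proof.
move=> xT; pose P := [pred z : T | (x <= z) && (z < \top)].
have Px : P x by rewrite /= lexx.
(* The size of the down-set is strictly monotone, so maximizing it yields a maximal element below
   the top. *)
case: (arg_maxnP (fun z : T => #|[pred t | (t <= z)%O]|) Px) => c /andP[xc cT] cmax.
exists c => //; rewrite /coatom /covers cT; apply/forallP => z; apply/negP => /andP[cz zT].
have := cmax z; rewrite /= (le_trans xc (ltW cz)) zT => /(_ isT); apply/negP.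
rewrite -ltnNge; apply: proper_card; apply/properP; split.
  by apply/subsetP => t; rewrite !inE => /le_trans; apply; apply: ltW.
by exists z; rewrite !inE ?lexx ?(lt_geF cz).
Qed.

Lemma sum_mobius x y : x <= y ->
  (\sum_(z : T | (x <= z <= y)%O) mobius x z = (x == y)%:R)%R.
Proof.
move=> xy; rewrite (bigD1 y) /=; last by rewrite xy lexx.
have [->|xNy] := eqVneq x y.
  rewrite mobius_refl big1 ?addr0 // => z /andP[yzy /negP[]].
  by rewrite eq_le andbC.
rewrite mobius_lt ?lt_neqAle ?xNy // addrC; apply/eqP; rewrite subr_eq0; apply/eqP.
by apply: eq_bigl => z; rewrite lt_neqAle -andbA [(z <= y) && _]andbC.
Qed.

(** Möbius inversion: once the right-hand side [f] is known to satisfy [sum_f], substitute it into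
    the sum of [mobius x z * [z = \top]], exchange the sums, and only [f x] survives. *)
Lemma mobius_crosscut x :
  (mobius x \top = \sum_(S : {set T} | (S \subset [set c | coatom c])
                      && (\meet_(c in S) c == x)%O) (-1) ^+ #|S|)%R.
Proof.
pose f (z : T) : int := (\sum_(S : {set T} | (S \subset [set c | coatom c])
                      && (\meet_(c in S) c == z)%O) (-1) ^+ #|S|)%R.
have sum_f z : (\sum_(w : T | (z <= w)%O) f w = (z == \top)%:R)%R.
  (* The meet of [S] lies above [z] exactly when every member of [S] does. *)
  transitivity (\sum_(S : {set T} | S \subset [set c | coatom c & (z <= c)%O])
                  (-1) ^+ #|S| : int)%R.
    rewrite (exchange_big_dep (fun S : {set T} => S \subset [set c | coatom c & (z <= c)%O])) /=.
      apply: eq_bigr => S /subsetP SA; rewrite (big_pred1 (\meet_(c in S) c)) // => w /=.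
      rewrite eq_sym; case: eqP => [->|_]; rewrite ?andbF // andbT.
      apply/andP; split; first by apply/meetsP => c /SA; rewrite inE => /andP[].
      by apply/subsetP => c /SA; rewrite !inE => /andP[].
    move=> w S zw /andP[/subsetP SC /eqP wE]; apply/subsetP => c cS.
    have := SC c cS; rewrite !inE => -> /=; apply: le_trans zw _.
    by rewrite -wE; apply: meets_inf.
  (* The sum is 1 or 0 according to whether no coatom lies above [z], which happens only at the
     top. *)
  rewrite sum_signr_subset; congr (nat_of_bool _)%:R%R.
  apply/eqP/eqP => [A0|->].
    apply/eqP/negPn/negP => zNT; have [|c cc zc] := @coatom_above z.
      by rewrite lt_neqAle zNT lex1.
    by have := in_set0 c; rewrite -A0 inE cc zc.
  apply/setP => c; rewrite !inE; apply/negP => /andP[/andP[cT _]].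
  by rewrite lt_geF.
have <- : (\sum_(z : T | (x <= z)%O) mobius x z * (z == \top)%:R = mobius x \top)%R.
  rewrite (bigD1 \top) ?lex1 //= eqxx mulr1 big1 ?addr0 // => z /andP[_ /negPf ->].
  by rewrite mulr0.
under eq_bigr do rewrite -sum_f mulr_sumr.
rewrite (exchange_big_dep (fun w : T => x <= w)) /=; last by move=> z w; apply: le_trans.
under eq_bigr => w xw do rewrite -mulr_suml sum_mobius //.
rewrite (bigD1 x) //= eqxx mul1r big1 ?addr0 // => w /andP[_].
by rewrite eq_sym => /negPf ->; rewrite mul0r.
Qed.

(* The hypothesis says that no coatom lies above the meet of all the others,
   so a set of coatoms is determined by its meet. *)
Lemma mobius_top_irredundant :
  (forall c (S : {set T}), coatom c -> {in S, forall c', coatom c'} -> c \notin S ->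
     ~~ (\meet_(c' in S) c' <= c)) ->
  forall x,
  (forall k, meet_of_coatoms k x -> mobius x \top = ((-1) ^+ k)%R) /\
  ((~ exists k, meet_of_coatoms k x) -> mobius x \top = 0%R).
Proof.
move=> irr x; split=> [k [S [<- SC ->]]|nx]; rewrite mobius_crosscut.
  rewrite (big_pred1 S) // => S'; apply/andP/eqP => [[/subsetP S'C /eqP eqS]|->].
    have sub (U V : {set T}) : {in U, forall c, coatom c} -> {in V, forall c, coatom c} ->
        \meet_(c in U) c = \meet_(c in V) c -> U \subset V.
      move=> UC VC eUV; apply/subsetP => c cU; apply/negPn/negP => cV.
      by have /negP[] := irr c V (UC c cU) VC cV; rewrite -eUV; apply: meets_inf.
    have {}S'C : {in S', forall c, coatom c} by move=> c /S'C; rewrite inE.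
    by apply/eqP; rewrite eqEsubset !sub.
  by split=> //; apply/subsetP => c /SC; rewrite inE.
rewrite big_pred0 // => S; apply/negP => /andP[/subsetP SC /eqP xE].
by case: nx; exists #|S|, S; split=> // c /SC; rewrite inE.
Qed.

End Crosscut.

Lemma mem_meets n (S : {set APset n}) (i : 'I_n) :
  (forall c, c \in S -> i \in ap_set c) -> i \in ap_set (\meet_(c in S) c)%O.
Proof.
move=> iS; elim/big_ind: _ => // [|x y ix iy]; first by rewrite ap_set_top inE.
by rewrite ap_set_meet inE ix iy.
Qed.

(** * Classification of the coatoms of the lattice of progressions *)

Section Coatoms.
Variable N : nat.
Implicit Types (c : APset N.+1) (A : {set 'I_N.+1}).

Lemma coatom_neqT c : coatom c -> ap_set c <> [set: 'I_N.+1].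
Proof.
move=> /andP[cT _] cE; have {}cE : c = \top%O by apply: val_inj.
by rewrite cE ltxx in cT.
Qed.

Lemma coatom_gt0 c : coatom c -> ord0 \in ap_set c -> 0 < N.
Proof.
move=> cc c0; rewrite lt0n; apply/eqP => N0; apply: (coatom_neqT cc).
apply/setP => i; rewrite (_ : i = ord0) ?c0 ?inE //; apply: ord_inj => /=.
by have := ltn_ord i; lia.
Qed.

(** Serves to identify a coatom from any proper progression containing it; [i] certifies
    properness. *)
Lemma coatom_max c A i : coatom c -> is_ap A -> ap_set c \subset A -> i \notin A ->
  ap_set c = A.
Proof.
move=> /andP[_ /forallP cmax] apA cA iA; pose a := MkAPset apA.
have aT : (a < \top)%O.
  rewrite lt_neqAle lex1 andbT; apply: contraNneq iA => /(congr1 (@ap_set _)) /= ->.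
  by rewrite inE.
have := cmax a; rewrite aT andbT lt_neqAle ap_leE cA andbT negbK => /eqP.
by move/(congr1 (@ap_set _)).
Qed.

Lemma is_ap_setC0 : is_ap [set~ ord0 : 'I_N.+1].
Proof.
have [N0|N0] := posnP N.
  (* For [N = 0] the complement is empty, and the first term 1 used below does not exist. *)
  rewrite (_ : [set~ ord0] = set0) ?is_ap0 //; apply/setP => i; rewrite !inE.
  by have := ltn_ord i; rewrite -val_eqE /=; lia.
apply: (@ap_intro _ _ (inord 1) ord_max 1) => // i.
by rewrite !inE dvd1n leq_ord !andbT inordK // -val_eqE /= lt0n.
Qed.

Lemma is_ap_setCmax : is_ap [set~ ord_max : 'I_N.+1].
Proof.
have [N0|N0] := posnP N.
  rewrite (_ : [set~ ord_max] = set0) ?is_ap0 //; apply/setP => i; rewrite !inE.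
  by have := ltn_ord i; rewrite -val_eqE /=; lia.
apply: (@ap_intro _ _ ord0 (inord N.-1) 1) => // i.
rewrite !inE dvd1n andbT inordK -?val_eqE /=; last by lia.
by have := ltn_ord i; lia.
Qed.

Lemma is_ap_multiples r : 0 < r -> is_ap [set i : 'I_N.+1 | r %| i].
Proof.
move=> r0; apply: (@ap_intro _ _ ord0 ord_max r) => // i.
by rewrite inE leq_ord subn0.
Qed.

Lemma coatom_setC0 c : coatom c -> ord0 \notin ap_set c -> ap_set c = [set~ ord0].
Proof.
move=> cc c0; apply: (coatom_max (i := ord0)) => //; first exact: is_ap_setC0.
  by rewrite subsetC sub1set inE.
by rewrite !inE eqxx.
Qed.

Lemma coatom_setCmax c : coatom c -> ord_max \notin ap_set c ->
  ap_set c = [set~ ord_max].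
Proof.
move=> cc c0; apply: (coatom_max (i := ord_max)) => //; first exact: is_ap_setCmax.
  by rewrite subsetC sub1set inE.
by rewrite !inE eqxx.
Qed.

(** A progression through 0 and [N] consists of the multiples of its difference [r]. The multiples
    of a prime factor of [r] form a proper progression containing it, so maximality forces
    equality. *)
Lemma coatom_multiples c : coatom c -> ord0 \in ap_set c -> ord_max \in ap_set c ->
  exists p, [/\ prime p, p %| N & ap_set c = [set i : 'I_N.+1 | p %| i]].
Proof.
move=> cc c0 cN.
have [r cE] : exists r, forall i : 'I_N.+1, (i \in ap_set c) = (r %| i).
  have [c_0|[a [b [r cE]]]] := is_ap_cases (valP c).
    by rewrite c_0 inE in c0.
  (* The bounds refer to [i.+1], so [a] is 0 or 1; membership of 0 gives [r %| 1 - a], which absorbs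
     the shift. *)
  exists r => i; move: c0 cN; rewrite !cE /= => /and3P[a1 _ ra] /and3P[_ Nb _].
  rewrite (leq_trans a1) // (leq_trans _ Nb) /= ?ltnS ?leq_ord //.
  by rewrite (_ : i.+1 - a = i + (1 - a)) ?dvdn_addl //; lia.
have rN : r %| N by rewrite -[N]/(val (@ord_max N)) -cE.
have N0 := coatom_gt0 cc c0.
have r1 : 1 < r.
  case: r cE rN => [|[|r]] // cE rN; first by rewrite dvd0n in rN; lia.
  by case: (coatom_neqT cc); apply/setP => i; rewrite cE dvd1n inE.
have pr := pdiv_prime r1.
exists (pdiv r); split=> //; first exact: dvdn_trans (pdiv_dvd r) rN.
(* The index 1 is no multiple of a prime, so the multiples form a proper subset. *)
apply: (coatom_max (i := inord 1)) => //.
- exact: is_ap_multiples (prime_gt0 pr).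
- by apply/subsetP => i; rewrite cE inE => /(dvdn_trans (pdiv_dvd r)).
- by rewrite inE inordK // dvdn1; case: eqP pr => // ->.
Qed.

(* Missing 0 or N leaves a single possible coatom; for the multiples of p the
   witness is the p'-part of N, which is divisible by all other primes of N. *)
Lemma coatom_witness c : coatom c ->
  exists2 i, i \notin ap_set c &
    forall c', coatom c' -> c' <> c -> i \in ap_set c'.
Proof.
move=> cc.
have [c0|c0] := boolP (ord0 \in ap_set c); last first.
  exists ord0 => // c' cc' c'c; apply/negPn/negP => c'0; apply: c'c.
  by apply: val_inj; rewrite /= (coatom_setC0 cc c0) (coatom_setC0 cc' c'0).
have [cN|cN] := boolP (ord_max \in ap_set c); last first.
  exists ord_max => // c' cc' c'c; apply/negPn/negP => c'N; apply: c'c.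
  by apply: val_inj; rewrite /= (coatom_setCmax cc cN) (coatom_setCmax cc' c'N).
have [p [pr pN cE]] := coatom_multiples cc c0 cN.
have N0 := coatom_gt0 cc c0.
have wN : N`_p^' < N.+1 by rewrite ltnS dvdn_leq ?dvdn_part.
have pNw : ~~ (p %| N`_p^').
  rewrite -prime_coprime // (pnat_coprime (pi := p)) ?pnat_id //.
  exact: part_pnat.
exists (Ordinal wN); first by rewrite cE inE.
move=> c' cc' c'c.
have [c'0|c'0] := boolP (ord0 \in ap_set c'); last first.
  by rewrite (coatom_setC0 cc' c'0) !inE -val_eqE /= -lt0n part_gt0.
have [c'N|c'N] := boolP (ord_max \in ap_set c'); last first.
  rewrite (coatom_setCmax cc' c'N) !inE -val_eqE /=.
  (* The witness differs from [N], since [p] divides [N] only. *)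
  by apply: contraNneq pNw => ->.
have [q [qr qN c'E]] := coatom_multiples cc' c'0 c'N.
rewrite c'E inE /=.
have qp : q != p by apply/eqP => qp; apply: c'c; apply: val_inj; rewrite /= cE c'E qp.
(* A prime other than [p] is its own p'-part, and taking p'-parts preserves divisibility. *)
have -> : q = q`_p^' by rewrite part_pnat_id // pnatE // inE.
exact: partn_dvd.
Qed.

End Coatoms.

Theorem theorem7 (n : nat) (hn : (1 <= n)%N) (x : APset n) (hx : x <> (\top)%O) :
  (forall k : nat, meet_of_coatoms k x -> mobius x (\top)%O = ((-1) ^+ k)%R) /\
  ((~ exists k : nat, meet_of_coatoms k x) -> mobius x (\top)%O = 0%R).
Proof.
case: n hn x hx => // N _ x _; apply: mobius_top_irredundant => c S cc SC cS.
(* The witness [i] lies in every member of [S], hence in their meet, but not in [c]. *)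
have [i ic iother] := coatom_witness cc.
apply: contra ic; rewrite ap_leE => /subsetP; apply; apply: mem_meets => c' c'S.
apply: iother; first exact: SC.
by move=> E; rewrite -E c'S in cS.
Qed.
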